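(* Let $t, s \ge 0$, $k \ge s+1$ and $n \ge 2k+t$ be integers. Let $\mathcal{F} \subseteq \binom{[n]}{k+t}$ and $\mathcal{G} \subseteq \binom{[n]}{k}$ be cross-intersecting families. If $\mathcal{F}$ is $(t+1)$-intersecting and $\binom{[k+t+s]}{k+t} \subseteq \mathcal{F}$, then $$|\mathcal{F}|+|\mathcal{G}| \le \binom{k+t+s}{k+t}+\binom{n}{k}-\sum_{i=0}^{s}\binom{k+t+s}{i}\binom{n-k-t-s}{k-i}.$$
   Context: $[n]=\{1,2,\ldots,n\}$, and for a set $X$, $\binom{X}{k}$ denotes the family of all $k$-element subsets of $X$. Two families $\mathcal{F},\mathcal{G}\subseteq 2^{[n]}$ are cross-intersecting if $|F\cap G|\ge 1$ for all $F\in\mathcal{F}$ and $G\in\mathcal{G}$. A family $\mathcal{F}\subseteq 2^{[n]}$ is $r$-intersecting if $|F\cap F'|\ge r$ for all $F,F'\in\mathcal{F}$. A binomial coefficient $\binom{a}{b}$ with integers $0\le a<b$ is $0$. *)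

(* Defs.v *)
From mathcomp Require Import all_boot.

Set Implicit Arguments.
Unset Strict Implicit.
Unset Printing Implicit Defensive.

(* The k-element subsets of X. *)
Definition ksubsets (T : finType) (X : {set T}) (k : nat) : {set {set T}} :=
  [set A : {set T} | A \subset X & #|A| == k].

(* The ground set [n] is encoded as 'I_n = {0, ..., n-1}, so the initial
   segment [m] of [n] consists of the indices i < m; this has m elements
   exactly when m <= n. *)
Definition initseg (n m : nat) : {set 'I_n} := [set i : 'I_n | i < m].

Definition cross_intersecting (T : finType) (F G : {set {set T}}) : Prop :=
  forall A B : {set T}, A \in F -> B \in G -> 1 <= #|A :&: B|.

(* A and B are not required to be distinct. *)
Definition r_intersecting (T : finType) (r : nat) (F : {set {set T}}) : Prop :=
  forall A B : {set T}, A \in F -> B \in F -> r <= #|A :&: B|.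

(* Main.v *)
Require Import Defs.
From mathcomp Require Import all_boot all_order all_algebra all_fingroup zify.

Import Order.TTheory GRing.Theory Num.Theory.

(** Shifting reduces to the case where F is shifted. Put m = k + t + s and
    [q] = {0, ..., q-1}, and for A in F consider the walk
    W(q) = |A ∩ [q]| - |[q] \ A|. As F is shifted and (t+1)-intersecting, W
    exceeds t somewhere, while W(n) <= t; let p be the last q with W(q) = t.
    The reflected set B = ([p] \ A) ∪ (A \ [p]) has k elements and determines
    A, and some member of the shifted family F is disjoint from B, so B is not
    in G. If A is not contained in [m], then |B ∩ [m]| > s. Every member of G
    also has more than s elements in [m], since F contains all (k+t)-subsets of
    [m]. So the reflections of the sets A not contained in [m], the family G,
    and the k-sets with at most s elements in [m] are pairwise disjoint. *)
Set Implicit Arguments.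
Unset Strict Implicit.

Lemma exists_subset_card (T : finType) (A : {set T}) (r : nat) :
  r <= #|A| -> exists2 U : {set T}, U \subset A & #|U| = r.
Proof.
rewrite -bin_gt0 -cards_draws => /card_gt0P[U].
by rewrite inE => /andP[UA /eqP Ur]; exists U.
Qed.

(** * The (i, j)-shift of a family of sets *)

Section Shift.
Variables (T : finType) (i j : T).
Implicit Types (X Y : {set T}) (A B : {set {set T}}).

(** A transposition is its own inverse, so this preimage is also the image; as a preimage, its
    membership unfolds by rewriting. *)
Definition swap_set X : {set T} := tperm i j @^-1: X.

Lemma swap_setK : involutive swap_set.
Proof. by move=> X; apply/setP=> x; rewrite !inE tpermK. Qed.

Lemma card_swap_set X : #|swap_set X| = #|X|.
Proof. by rewrite card_preimset //; apply: perm_inj. Qed.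

Lemma swap_setI X Y : swap_set (X :&: Y) = swap_set X :&: swap_set Y.
Proof. exact: preimsetI. Qed.

Lemma swap_set_id X : (i \in X) = (j \in X) -> swap_set X = X.
Proof. by move=> ij; apply/setP=> x; rewrite inE; case: tpermP => // ->. Qed.

Lemma swap_setE X : j \in X -> i \notin X -> swap_set X = i |: (X :\ j).
Proof.
move=> jX iX; apply/setP=> x; rewrite !inE.
case: tpermP => [->|->|/eqP/negPf xi /eqP/negPf xj]; rewrite ?eqxx ?jX //=.
  by rewrite orbF (negPf iX); apply/esym/negP=> /eqP ji; rewrite ji (negPf iX) in jX.
by rewrite xi xj.
Qed.

(** The usual replacement of [j] by [i], blocked when the result is already in [A]. If [X] contains
    neither point, the swap fixes it. *)
Definition shift_set A X : {set T} :=
  if (i \notin X) && (swap_set X \notin A) then swap_set X else X.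

Definition shift A : {set {set T}} := shift_set A @: A.

(** A moved set lands outside [A] and a kept set stays inside, so only two sets of the same kind can
    collide, and the swap is injective. *)
Lemma shift_set_inj A : {in A &, injective (shift_set A)}.
Proof.
move=> X Y XA YA; rewrite /shift_set.
case: ifP => [/andP[_ sX]|_]; case: ifP => [/andP[_ sY]|_] // E.
- exact: (inv_inj swap_setK).
- by rewrite E YA in sX.
- by rewrite -E XA in sY.
Qed.

Lemma card_shift A : #|shift A| = #|A|.
Proof. exact: card_in_imset (@shift_set_inj A). Qed.

Lemma card_shift_set A X : #|shift_set A X| = #|X|.
Proof. by rewrite /shift_set; case: ifP => // _; rewrite card_swap_set. Qed.

Lemma shift_uniform A r :
  A \subset ksubsets [set: T] r -> shift A \subset ksubsets [set: T] r.
Proof.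
move=> /subsetP AK; apply/subsetP=> _ /imsetP[X XA ->].
by have := AK X XA; rewrite !inE !subsetT card_shift_set.
Qed.

(** The mixed case, [X] swapped and [Y] kept. If [swap_set Y] lies in [B], the swap is passed from
    [X] to [Y]. Otherwise [i \in Y]: either [Y] is fixed by the swap, or [X :&: Y] contains neither
    [i] nor [j] and survives it. *)
Lemma shift_set_cross_aux A B r X Y :
  (forall X Y, X \in A -> Y \in B -> r <= #|X :&: Y|) ->
  X \in A -> Y \in B -> i \notin X -> (i \notin Y) && (swap_set Y \notin B) = false ->
  r <= #|swap_set X :&: Y|.
Proof.
move=> AB XA YB iX; case: (boolP (i \in Y)) => iY /= => [_|/negbFE sYB]; last first.
  by rewrite -card_swap_set swap_setI swap_setK AB.
apply: leq_trans (AB X Y XA YB) _.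
case: (boolP (j \in Y)) => jY.
  by rewrite -card_swap_set swap_setI (@swap_set_id Y) ?iY ?jY.
apply: subset_leq_card; apply/subsetP=> x; rewrite !inE => /andP[xX xY].
rewrite xY andbT; case: tpermP => // xE; rewrite xE in xX xY.
  by rewrite xX in iX.
by rewrite xY in jY.
Qed.

Lemma shift_cross A B r :
  (forall X Y, X \in A -> Y \in B -> r <= #|X :&: Y|) ->
  forall X Y, X \in shift A -> Y \in shift B -> r <= #|X :&: Y|.
Proof.
move=> AB _ _ /imsetP[X XA ->] /imsetP[Y YB ->].
have BA : forall Y X, Y \in B -> X \in A -> r <= #|Y :&: X|.
  by move=> Y' X' ? ?; rewrite setIC AB.
rewrite /shift_set; case: ifP => [/andP[iX _]|EX]; case: ifP => [/andP[iY _]|EY].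
- by rewrite -swap_setI card_swap_set AB.
- exact: (shift_set_cross_aux AB).
- by rewrite setIC (shift_set_cross_aux BA).
- exact: AB.
Qed.

(** Each [X] in [ksubsets M r] stays put: trading [j] for [i] keeps it inside [M], so the swapped
    set already belongs to [A]. *)
Lemma shift_ksubsets A (M : {set T}) r :
  (j \in M -> i \in M) -> ksubsets M r \subset A -> ksubsets M r \subset shift A.
Proof.
move=> ijM /subsetP MA; apply/subsetP=> X XM; apply/imsetP; exists X; first exact: MA.
rewrite /shift_set; case: ifP => // /andP[iX /negP[]].
case: (boolP (j \in X)) => jX; last first.
  by rewrite swap_set_id ?MA // (negPf iX) (negPf jX).
apply: MA; move: XM; rewrite !inE card_swap_set => /andP[XM ->]; rewrite andbT.
rewrite swap_setE // subUset sub1set ijM ?(subsetP XM) //=.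
by rewrite (subset_trans (subD1set _ _)).
Qed.

End Shift.

(** * Shifted families and termination of shifting *)

Definition shifted (n : nat) (F : {set {set 'I_n}}) : Prop :=
  forall (i j : 'I_n) (X : {set 'I_n}),
  i < j -> X \in F -> j \in X -> i \notin X -> i |: (X :\ j) \in F.

(** A potential that drops with every effective shift, since [j] gives way to a smaller [i]. *)
Definition weight (n : nat) (F : {set {set 'I_n}}) : nat :=
  \sum_(X in F) \sum_(x in X) x.

Lemma weight_shift_lt (n : nat) (F : {set {set 'I_n}}) (i j : 'I_n) (X : {set 'I_n}) :
  i < j -> X \in F -> j \in X -> i \notin X -> i |: (X :\ j) \notin F ->
  weight (shift i j F) < weight F.
Proof.
move=> ij XF jX iX XnF.
have sum_swap (Y : {set 'I_n}) : j \in Y -> i \notin Y ->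
    \sum_(x in swap_set i j Y) x < \sum_(x in Y) x.
  move=> jY iY; rewrite swap_setE // big_setU1 /=; last by rewrite !inE (negPf iY) andbF.
  by rewrite (big_setD1 j jY) /= ltn_add2r.
rewrite /weight big_imset /=; last exact: shift_set_inj.
rewrite (big_setD1 X XF) [X in _ < X](big_setD1 X XF) /= -addSn leq_add //.
  by rewrite /shift_set iX (swap_setE jX iX) XnF /= -swap_setE // sum_swap.
apply: leq_sum => Y; rewrite !inE => /andP[_ YF]; rewrite /shift_set.
case: ifP => // /andP[iY sY]; apply/ltnW/sum_swap => //.
by apply: contraR sY => jY; rewrite swap_set_id // (negPf iY) (negPf jY).
Qed.

(** * Walks of members of a shifted family *)

Section Shifted.
Variable n : nat.
Implicit Types (F : {set {set 'I_n}}) (A B S : {set 'I_n}).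

(** For [q <= n] the walk has height [2 * cnt A q - q]; height conditions are written as comparisons
    of [2 * cnt A q] with [q + t] to avoid subtraction. *)
Definition cnt A (q : nat) : nat := #|A :&: initseg n q|.

Lemma card_initseg q : q <= n -> #|initseg n q| = q.
Proof.
move=> qn; have E : initseg n q = [set widen_ord qn x | x in [set: 'I_q]].
  apply/setP=> x; rewrite inE; apply/idP/imsetP=> [xq|[y _ ->]] /=; last exact: ltn_ord.
  by exists (Ordinal xq); [rewrite inE | apply: ord_inj].
by rewrite E card_imset ?cardsT ?card_ord // => x y [] /ord_inj.
Qed.

Lemma cnt_full A : cnt A n = #|A|.
Proof. by apply: eq_card => x; rewrite !inE ltn_ord andbT. Qed.

Lemma cnt0 A : cnt A 0 = 0.
Proof. by apply: eq_card0 => x; rewrite !inE andbF. Qed.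

Lemma cntC A q : q <= n -> cnt A q + cnt (~: A) q = q.
Proof.
move=> qn; rewrite -[RHS](card_initseg qn) /cnt -(cardsID A (initseg n q)).
by rewrite setIC setDE [~: A :&: _]setIC.
Qed.

Lemma cntS A q : cnt A q <= cnt A q.+1 <= (cnt A q).+1.
Proof.
have sub : initseg n q \subset initseg n q.+1 by apply/subsetP=> x; rewrite !inE; lia.
have D : A :&: initseg n q.+1 :\: A :&: initseg n q \subset initseg n q.+1 :\: initseg n q.
  by apply/subsetP=> x; rewrite !inE; case: (x \in A).
rewrite subset_leq_card ?setIS //=.
rewrite /cnt -(cardsID (A :&: initseg n q) (A :&: initseg n q.+1)).
rewrite (setIidPr (setIS A sub)) -[X in _ <= X]addn1 leq_add2l; apply: leq_trans (subset_leq_card D) _.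
apply/card_le1_eqP=> x y; rewrite !inE => ? ?; apply: ord_inj; lia.
Qed.

Lemma cnt_split A p q : p <= q -> cnt (A :\: initseg n p) q = cnt A q - cnt A p.
Proof.
move=> pq; apply/esym/(canLR (addKn _)).
rewrite /cnt -(cardsID (initseg n p) (A :&: initseg n q)).
by congr (_ + _); apply: eq_card => x; rewrite !inE; lia.
Qed.

Lemma cnt_split0 A p q : q <= p -> cnt (A :\: initseg n p) q = 0.
Proof. by move=> pq; apply: eq_card0=> x; rewrite !inE; lia. Qed.

Lemma leq_cnt A p q : p <= q -> cnt A p <= cnt A q.
Proof. by move=> pq; apply: subset_leq_card; apply/subsetP=> x; rewrite !inE; lia. Qed.

(* Induction on #|B|: the smallest element of B is traded for a smaller element
   of S. *)
Lemma shifted_exchange F A B S :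
  shifted F -> A \in F -> B \subset A -> [disjoint S & A] ->
  (forall q, cnt B q <= cnt S q) ->
  exists A', [/\ A' \in F, A :\: B \subset A' & A' \subset (A :\: B) :|: S].
Proof.
move=> shF; move: {2}#|B| (erefl #|B|) => r; elim: r A B S => [|r IH] A B S Br AF BA SA BS.
  exists A; rewrite (cards0_eq Br) setD0; split=> //; exact: subsetUl.
have /card_gt0P[x0 x0B] : 0 < #|B| by rewrite Br.
case: (@arg_minnP _ x0 [in B] val x0B) => b /= bB bmin.
have /card_gt0P[a] : 0 < cnt S b.+1.
  by apply: leq_trans (BS b.+1); apply/card_gt0P; exists b; rewrite !inE bB /=.
rewrite !inE ltnS => /andP[aS ab].
have bA := subsetP BA b bB.
have aA : a \notin A by apply: contraL aS => aA; rewrite (disjointFl SA).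
have anb : a != b by apply: contraNneq aA => ->.
have ltab : a < b by rewrite ltn_neqAle ab andbT.
have AF' := shF a b A ltab AF bA aA.
have aB : a \notin B by apply: contra aA; apply: (subsetP BA).
have EA : (a |: A :\ b) :\: (B :\ b) = a |: (A :\: B).
  apply/setP=> x; rewrite !inE; case: (eqVneq x a) => [->|_] /=; first by rewrite (negPf aB) andbF.
  by case: (eqVneq x b) => [->|_] //=; rewrite bB.
have SA' : [disjoint S :\ a & a |: A :\ b].
  apply/pred0P=> x /=; rewrite !inE; case: (eqVneq x a) => //= _.
  by case: (boolP (x \in S)) => //= xS; rewrite (disjointFr SA xS) andbF.
case: (IH (a |: A :\ b) (B :\ b) (S :\ a) _ AF' _ SA') => [|||A' [A'F A'1 A'2]].
- by move: Br; rewrite (cardsD1 b) bB => -[].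
- by apply/subsetP=> x; rewrite !inE => /andP[-> /(subsetP BA) ->]; rewrite orbT.
(* Up to [b] the set [B :\ b] has no elements, by minimality of [b]; beyond [b] both counts drop by
   one, because [a < b]. *)
- move=> q; case: (leqP q b) => [qb|bq].
    rewrite /cnt (_ : _ :&: _ = set0) ?cards0 //; apply/setP=> x; rewrite !inE.
    by apply/negP=> /andP[/andP[_ /bmin]]; lia.
  have := BS q; rewrite /cnt (cardsD1 b) [X in _ <= X -> _](cardsD1 a) !inE bB aS bq.
  by rewrite (leq_ltn_trans ab bq) /= !setIDAC.
exists A'; rewrite EA in A'1 A'2; split=> //; first exact: subset_trans (subsetUr _ _) A'1.
apply: subset_trans A'2 _; rewrite !subUset subsetUl sub1set inE aS orbT /=.
exact: subset_trans (subsetDl _ _) (subsetUr _ _).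
Qed.

(* Otherwise all but the first t elements of A could be exchanged for
   nonelements of A. *)
Lemma shifted_walk F A t :
  shifted F -> r_intersecting (t + 1) F -> A \in F -> t < #|A| ->
  exists2 q, q <= n & q + t < 2 * cnt A q.
Proof.
move=> shF intF AF tA.
case: (boolP [exists q : 'I_n.+1, q + t < 2 * cnt A q]) => [/existsP[q qP]|/existsPn H].
  by exists q => //; rewrite -ltnS.
have {}H q : q <= n -> 2 * cnt A q <= q + t.
  by rewrite -ltnS => qn; rewrite leqNgt; apply: (H (Ordinal qn)).
have ex0 : exists p, cnt A p <= t by exists 0; rewrite cnt0.
have bnd p : cnt A p <= t -> p <= n.
  move=> pt; rewrite leqNgt; apply/negP=> np.
  have := leq_trans (leq_cnt A (ltnW np)) pt; rewrite cnt_full; lia.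
(* [p] is the largest index with at most [t] elements of [A] below it, hence exactly [t]. For
   [q >= p], the bound [H] on the walk is precisely the condition for exchanging the elements of [A]
   from [p] on. *)
case: (ex_maxnP ex0 bnd) => p pt pmax.
have pn := bnd p pt.
have pE : cnt A p = t.
  have := cntS A p; case: (leqP (cnt A p.+1) t) => [/pmax|]; lia.
have disj : [disjoint ~: A & A] by rewrite disjoints_subset.
case: (@shifted_exchange F A (A :\: initseg n p) (~: A) shF AF (subsetDl _ _) disj).
  move=> q; case: (leqP q p) => [qp|/ltnW pq]; first by rewrite cnt_split0.
  rewrite cnt_split // pE; case: (leqP q n) => [qn|/ltnW nq].
    have := H q qn; have := cntC A qn; lia.
  have -> : cnt A q = cnt A n by apply: eq_card=> x; rewrite !inE ltn_ord; have := ltn_ord x; lia.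
  have := H n (leqnn n); have := cntC A (leqnn n); have := leq_cnt (~: A) nq; lia.
move=> A' [A'F _ A'2]; have := intF A A' AF A'F.
have : A :&: A' \subset A :&: initseg n p.
  apply/subsetP=> x; rewrite !inE => /andP[xA /(subsetP A'2)]; rewrite !inE xA; lia.
by move/subset_leq_card; rewrite -/(cnt A p) pE; lia.
Qed.
(* The junk value is 0 when the walk of A never reaches t. *)
Definition last_hit (t : nat) A : nat :=
  \max_(q < n.+1 | q + t <= 2 * cnt A q) q.

(** The walk moves by single steps and ends at height at most [t], so its last index of height at
    least [t] has height exactly [t]. *)
Lemma last_hitP t A :
  (exists2 q, q <= n & q + t <= 2 * cnt A q) -> 2 * #|A| <= n + t ->
  [/\ last_hit t A <= n, 2 * cnt A (last_hit t A) = last_hit t A + t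
    & forall q, last_hit t A < q <= n -> 2 * cnt A q < q + t].
Proof.
move=> [q0]; rewrite -ltnS => q0n q0P cA; pose Q (q : 'I_n.+1) := q + t <= 2 * cnt A q.
have [|p pP pE] := @eq_bigmax_cond _ [in Q] (fun q => val q).
  by apply/card_gt0P; exists (Ordinal q0n).
have lE : last_hit t A = p by exact: pE.
have pn : p <= n by rewrite -ltnS.
have after q : last_hit t A < q <= n -> 2 * cnt A q < q + t.
  case/andP=> pq; rewrite -ltnS => qn; rewrite ltnNge; apply/negP=> qP.
  have : Ordinal qn <= last_hit t A by apply: (@leq_bigmax_cond _ _ _ (Ordinal qn)).
  by rewrite leqNgt pq.
split=> //; rewrite lE // in after *.
have {}pP : p + t <= 2 * cnt A p := pP.
case: (ltnP p n) => [ltpn|np].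
  have := after p.+1; rewrite ltnS leqnn => /(_ ltpn); have := cntS A p; lia.
have E : nat_of_ord p = n by apply/eqP; rewrite eqn_leq pn.
by move: pP; rewrite E cnt_full; lia.
Qed.

(** * Reflection of the walk up to its last hit *)

(** When [A] hits height [t] and ends no higher, the new walk is the negative of the old one up to
    the last hit and runs [2 * t] below it afterwards. *)
Definition reflect (t : nat) A : {set 'I_n} :=
  let I := initseg n (last_hit t A) in (I :\: A) :|: (A :\: I).

Section Reflect.
Variables (t : nat) (A : {set 'I_n}).
Hypotheses (hitA : exists2 q, q <= n & q + t <= 2 * cnt A q) (cardA : 2 * #|A| <= n + t).

Let p := last_hit t A.

Lemma cnt_reflect_le q : q <= p -> cnt (reflect t A) q + cnt A q = q.
Proof.
have [pn _ _] := last_hitP hitA cardA; rewrite -/p in pn => qp.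
rewrite -[RHS](cntC A (leq_trans qp pn)) addnC; congr (_ + _).
by apply: eq_card => x; rewrite !inE -/p; lia.
Qed.

Lemma cnt_reflect_ge q : p <= q -> cnt (reflect t A) q + t = cnt A q.
Proof.
have [pn pE _] := last_hitP hitA cardA; rewrite -/p in pn pE => pq.
have E : cnt (reflect t A) q = cnt (reflect t A) p + cnt (A :\: initseg n p) q.
  rewrite {1}/cnt -(cardsID (initseg n p)); congr (_ + _); apply: eq_card => x; rewrite !inE -/p.
    case: (ltnP x p) => xp; last by rewrite !andbF.
    by rewrite (leq_trans xp pq) !andbT.
  by case: (x < p); rewrite //= andbF.
have := cnt_reflect_le (leqnn p); rewrite E cnt_split //.
by have := leq_cnt A pq; lia.
Qed.

Lemma card_reflect : #|reflect t A| + t = #|A|.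
Proof. by rewrite -!cnt_full cnt_reflect_ge //; case: (last_hitP hitA cardA). Qed.

(* Beyond the last hit A always has fewer elements than nonelements, so they
   can be exchanged. *)
Lemma shifted_avoid_reflect F :
  shifted F -> A \in F -> exists2 A', A' \in F & A' :&: reflect t A = set0.
Proof.
move=> shF AF; have [pn pE after] := last_hitP hitA cardA; rewrite -/p in pn pE after.
have disj : [disjoint ~: A :\: initseg n p & A].
  by rewrite disjoints_subset; apply: subsetDl.
case: (@shifted_exchange F A (A :\: initseg n p) _ shF AF (subsetDl _ _) disj).
  move=> q; case: (leqP q p) => [qp|pq]; first by rewrite cnt_split0.
  rewrite !cnt_split ?(ltnW pq) //; have := cntC A pn.
  case: (leqP q n) => [qn|/ltnW nq].
    have := after q; rewrite pq qn => /(_ isT); have := cntC A qn; lia.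
  have -> : cnt A q = cnt A n.
    by apply: eq_card => x; rewrite !inE ltn_ord (leq_trans (ltn_ord x)).
  have := leq_cnt (~: A) nq; have := cntC A (leqnn n); have := cnt_full A; lia.
(* Before [p], [A'] lies in [A] and the reflection outside [A]; from [p] on, the roles are
   exchanged. *)
move=> A' [A'F _ A'2]; exists A' => //; apply/setP=> x; rewrite !inE -/p.
apply/negP=> /andP[/(subsetP A'2)]; rewrite !inE -/p.
by case: (x < p); case: (x \in A).
Qed.

End Reflect.

(** Equal reflections have equal last hits: at the later of two different hits, the walk with the
    earlier hit would be forced back to height [t]. With a common last hit, both sets are
    complemented on the same segment. *)
Lemma reflect_inj t :
  {in [pred A | [exists q : 'I_n.+1, q + t <= 2 * cnt A q] & 2 * #|A| <= n + t] &,
    injective (reflect t)}.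
Proof.
have hit A : [exists q : 'I_n.+1, q + t <= 2 * cnt A q] ->
    exists2 q, q <= n & q + t <= 2 * cnt A q.
  by case/existsP=> q qP; exists q => //; rewrite -ltnS.
have not_lt A B : reflect t A = reflect t B ->
    (exists2 q, q <= n & q + t <= 2 * cnt A q) -> 2 * #|A| <= n + t ->
    (exists2 q, q <= n & q + t <= 2 * cnt B q) -> 2 * #|B| <= n + t ->
    last_hit t B <= last_hit t A.
  move=> E hA cA hB cB; rewrite leqNgt; apply/negP=> lt.
  have [_ _ aA] := last_hitP hA cA; have [Bn BE _] := last_hitP hB cB.
  have := aA _ (introT andP (conj lt Bn)).
  have := cnt_reflect_ge hA cA (ltnW lt); rewrite E.
  have := cnt_reflect_le hB cB (leqnn _); lia.
move=> A B /andP[/hit hA cA] /andP[/hit hB cB] E.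
have pE : last_hit t A = last_hit t B by apply/eqP; rewrite eqn_leq !not_lt.
apply/setP=> x; move/setP/(_ x): E; rewrite /reflect pE !inE.
by case: (x < _); case: (x \in A); case: (x \in B).
Qed.

End Shifted.

(** * Induction along shifts *)

(** Strong induction on the weight of [F], which decreases as long as some shift changes [F]; [G]
    undergoes the same shifts. *)
Lemma shift_ind (n : nat) (P : {set {set 'I_n}} -> {set {set 'I_n}} -> Prop) :
  (forall F G, shifted F -> P F G) ->
  (forall F G (i j : 'I_n), i < j -> P (shift i j F) (shift i j G) -> P F G) ->
  forall F G, P F G.
Proof.
move=> Psh Pstep F G; have [w] := ubnP (weight F); elim: w F G => // w IH F G Fw.
pose moves (i j : 'I_n) (X : {set 'I_n}) :=
  [&& i < j, X \in F, j \in X, i \notin X & i |: (X :\ j) \notin F].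
case: (boolP [exists i, [exists j, [exists X, moves i j X]]]).
  case/existsP=> i /existsP[j /existsP[X /and5P[ij XF jX iX XnF]]].
  apply: (Pstep _ _ i j ij); apply: IH.
  exact: leq_trans (weight_shift_lt ij XF jX iX XnF) Fw.
move/existsPn=> noi; apply: Psh => i j X ij XF jX iX; apply/negPn/negP=> XnF.
have /existsPn/(_ j)/existsPn/(_ X)/negP[] := noi i.
exact/and5P.
Qed.

(** * Counting k-sets by their trace on a fixed set *)

(** Taking unions maps [D] bijectively onto the layer, with inverse sending [B] to
    [(B :&: M, B :\: M)]. *)
Lemma card_layer (T : finType) (M : {set T}) (k i : nat) : i <= k ->
  #|[set B : {set T} | #|B| == k & #|B :&: M| == i]| = 'C(#|M|, i) * 'C(#|~: M|, k - i).
Proof.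
move=> ik; pose D : {set {set T} * {set T}} := setX (ksubsets M i) (ksubsets (~: M) (k - i)).
have DE u : u \in D -> (u.1 :|: u.2) :&: M = u.1 /\ (u.1 :|: u.2) :\: M = u.2.
  rewrite !inE -andbA => /and4P[u1 _ /subsetP u2 _]; split; apply/setP=> x; rewrite !inE.
    case: (boolP (x \in u.1)) => [/(subsetP u1)->|_] //=.
    by apply/negP=> /andP[/u2]; rewrite inE => /negPf->.
  case: (boolP (x \in u.1)) => [x1|_] /=.
    by rewrite (subsetP u1 x x1); apply/esym/negP=> /u2; rewrite inE (subsetP u1 x x1).
  by case: (boolP (x \in u.2)) => [/u2|]; rewrite ?inE ?andbF // => ->.
rewrite -!cards_draws -cardsX -/(ksubsets M i) -/(ksubsets _ _) -/D.
rewrite -(card_in_imset (f := fun u => u.1 :|: u.2) (D := D)); last first.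
  move=> [a b] [c d] /DE[/= Ea Eb] /DE[/= Ec Ed] E.
  by congr pair; [rewrite -Ea E | rewrite -Eb E].
apply: eq_card => B; rewrite inE; apply/idP/imsetP.
  case/andP=> /eqP Bk /eqP Bi; exists (B :&: M, B :\: M); last by rewrite /= setID.
  rewrite !inE /= subsetIr Bi eqxx setDE subsetIr -setDE /=.
  by move: (cardsID M B); rewrite Bk Bi => <-; rewrite addKn.
move=> [u uD ->]; have [E1 E2] := DE u uD; rewrite E1 -(cardsID M) E1 E2.
move: uD; rewrite !inE => /andP[/andP[_ /eqP->] /andP[_ /eqP->]].
by rewrite subnKC ?eqxx.
Qed.

Lemma card_lower_layers (T : finType) (M : {set T}) (k r : nat) : r <= k.+1 ->
  #|[set B : {set T} | #|B| == k & #|B :&: M| < r]| =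
    \sum_(0 <= i < r) 'C(#|M|, i) * 'C(#|~: M|, k - i).
Proof.
elim: r => [|r IH] rk; first by rewrite big_geq //; apply: eq_card0 => B; rewrite !inE andbF.
rewrite big_nat_recr //= -IH 1?ltnW // -card_layer //.
rewrite -(cardsID [set B : {set T} | #|B :&: M| < r] [set B | _ & _ < r.+1]).
by congr (_ + _); apply: eq_card => B; rewrite !inE; case: (#|B| == k); rewrite ?andbF //=; lia.
Qed.

(** * The bound for shifted families *)

Section Bound.
Variables (t s k n : nat).
Hypotheses (sk : s < k) (kn : 2 * k + t <= n).
Variable m : nat.
Hypothesis mE : m = k + t + s.

(** Otherwise [A] misses [k] elements of [[m]]; together with [t] further elements of [[m]] they
    form a member of [F] meeting [A] in at most [t] elements. *)
Lemma miss_top_card (F : {set {set 'I_n}}) (A : {set 'I_n}) :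
  r_intersecting (t + 1) F -> ksubsets (initseg n m) (k + t) \subset F ->
  A \in F -> s + t < cnt A m.
Proof.
move=> intF /subsetP topF AF; rewrite ltnNge; apply/negP=> cA.
have mn : m <= n by rewrite mE; lia.
have cM := card_initseg mn.
have kD : k <= #|initseg n m :\: A|.
  by have := cardsID A (initseg n m); rewrite cM setIC -/(cnt A m); lia.
have [U UD Uk] := exists_subset_card kD.
have UM : U \subset initseg n m := subset_trans UD (subsetDl _ _).
have : t <= #|initseg n m :\: U|.
  by have := cardsID U (initseg n m); rewrite cM (setIidPr UM) Uk; lia.
case/exists_subset_card=> V VD Vt.
have UVF : U :|: V \in F.
  apply: topF; rewrite inE subUset UM (subset_trans VD (subsetDl _ _)) /= cardsU.
  have -> : U :&: V = set0.
    by apply/setP=> x; rewrite !inE; apply/negP=> /andP[xU /(subsetP VD)]; rewrite inE xU.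
  by rewrite cards0 subn0 Uk Vt.
have : A :&: (U :|: V) \subset V.
  apply/subsetP=> x; rewrite !inE => /andP[xA /orP[/(subsetP UD)|//]].
  by rewrite inE xA.
by move/subset_leq_card; have := intF _ _ AF UVF; rewrite Vt; lia.
Qed.

(** Otherwise [B] misses [k + t] elements of [[m]], and these form a member of [F] disjoint from
    [B]. *)
Lemma cross_top_card (F G : {set {set 'I_n}}) (B : {set 'I_n}) :
  cross_intersecting F G -> ksubsets (initseg n m) (k + t) \subset F ->
  B \in G -> s < cnt B m.
Proof.
move=> FG /subsetP topF BG; rewrite ltnNge; apply/negP=> cB.
have mn : m <= n by rewrite mE; lia.
have : k + t <= #|initseg n m :\: B|.
  by have := cardsID B (initseg n m); rewrite (card_initseg mn) setIC -/(cnt B m); lia.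
case/exists_subset_card=> A AD Ak.
have AF : A \in F by apply: topF; rewrite inE Ak eqxx (subset_trans AD (subsetDl _ _)).
have := FG _ _ AF BG; rewrite (_ : A :&: B = set0) ?cards0 //.
by apply/setP=> x; rewrite !inE; apply/negP=> /andP[/(subsetP AD)]; rewrite inE => /andP[/negPf->].
Qed.

Lemma shifted_bound (F G : {set {set 'I_n}}) :
  shifted F ->
  F \subset ksubsets [set: 'I_n] (k + t) ->
  G \subset ksubsets [set: 'I_n] k ->
  cross_intersecting F G ->
  r_intersecting (t + 1) F ->
  ksubsets (initseg n m) (k + t) \subset F ->
  #|F :\: ksubsets (initseg n m) (k + t)| + #|G| +
    #|[set B : {set 'I_n} | #|B| == k & cnt B m < s.+1]| <= 'C(n, k).
Proof.
move=> shF /subsetP Fk /subsetP Gk FG intF topF.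
set N := [set B | _ & _]; set F' := F :\: _.
have mn : m <= n by rewrite mE; lia.
have cardF A : A \in F -> #|A| = k + t by move/Fk; rewrite inE => /andP[_ /eqP].
have cardF2 A : A \in F -> 2 * #|A| <= n + t by move/cardF->; lia.
have hit A : A \in F -> exists2 q, q <= n & q + t <= 2 * cnt A q.
  move=> AF; have tA : t < #|A| by rewrite cardF //; lia.
  by have [q qn /ltnW qP] := shifted_walk shF intF AF tA; exists q.
pose R := reflect t @: F'.
have RF' B : B \in R -> exists2 A, A \in F & cnt A m < k + t /\ B = reflect t A.
  case/imsetP=> A; rewrite !inE => /andP[AM AF] ->; exists A => //; split=> //.
  rewrite -(cardF A AF) ltn_neqAle subset_leq_card ?subsetIl // andbT.
  apply: contra AM => /eqP cA; rewrite cardF // eqxx andbT.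
  by apply/setIidPl/eqP; rewrite eqEcard subsetIl -[X in X <= _]cA leqnn.
have cardR : #|R| = #|F'|.
  apply: card_in_imset => A B; rewrite !inE => /andP[_ AF] /andP[_ BF].
  apply: reflect_inj; rewrite inE cardF2 // andbT.
    by have [q qn qP] := hit A AF; apply/existsP; exists (Ordinal (qn : q < n.+1)).
  by have [q qn qP] := hit B BF; apply/existsP; exists (Ordinal (qn : q < n.+1)).
have Rk B : B \in R -> #|B| = k.
  by case/RF'=> A AF [_ ->]; have := card_reflect (hit A AF) (cardF2 A AF); rewrite (cardF A AF); lia.
have Rs B : B \in R -> s < cnt B m.
  case/RF'=> A AF [Akt ->]; have := miss_top_card intF topF AF.
  (* If [m] is at most the last hit, [B] has [m - cnt A m > s] elements in [[m]], as
     [cnt A m < k + t]; otherwise it has [cnt A m - t > s]. *)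
  case: (leqP m (last_hit t A)) => [mp|/ltnW pm].
    by have := cnt_reflect_le (hit A AF) (cardF2 A AF) mp; lia.
  by have := cnt_reflect_ge (hit A AF) (cardF2 A AF) pm; lia.
have RG : [disjoint R & G].
  apply/pred0P=> B /=; apply/negP=> /andP[/RF'[A AF [_ ->]] BG].
  have [A' A'F A'B] := shifted_avoid_reflect (hit A AF) (cardF2 A AF) shF AF.
  by have := FG _ _ A'F BG; rewrite A'B cards0.
have RGN : [disjoint R :|: G & N].
  apply/pred0P=> B /=; rewrite !inE; apply/negP=> /andP[RGB /andP[_]].
  rewrite ltnS leqNgt => /negP[]; case/orP: RGB; first exact: Rs.
  exact: cross_top_card FG topF.
have <- : #|R :|: G :|: N| = #|F'| + #|G| + #|N|.
  rewrite -cardR; have /leqifP := leq_card_setU (R :|: G) N; rewrite RGN => /eqP->.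
  by have /leqifP := leq_card_setU R G; rewrite RG => /eqP->.
rewrite -[n in 'C(n, k)]card_ord -cardsT -cards_draws; apply: subset_leq_card.
apply/subsetP=> B; rewrite !inE subsetT /= => /orP[/orP[/Rk->|/Gk]|/andP[]] //.
by rewrite inE => /andP[].
Qed.

End Bound.

(** * The bound for arbitrary families *)

Unset Implicit Arguments.
Set Strict Implicit.

Theorem mainTheorem1 (t s k n : nat) (F G : {set {set 'I_n}}) :
  s + 1 <= k ->
  2 * k + t <= n ->
  F \subset ksubsets [set: 'I_n] (k + t) ->
  G \subset ksubsets [set: 'I_n] k ->
  cross_intersecting F G ->
  r_intersecting (t + 1) F ->
  ksubsets (initseg n (k + t + s)) (k + t) \subset F ->
  ((#|F|%:Z + #|G|%:Z)%R <=
     'C(k + t + s, k + t)%:Z + 'C(n, k)%:Z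
     - (\sum_(0 <= i < s.+1)
          'C(k + t + s, i) * 'C(n - k - t - s, k - i))%N%:Z)%R.
Proof.
move=> sk kn; rewrite addn1 in sk; have mn : k + t + s <= n by lia.
have cM := card_initseg mn; have cMC : #|~: initseg n (k + t + s)| = n - (k + t + s) by rewrite cardsCs setCK cM card_ord.
(* The hypotheses on [F] and [G] stay in the induction predicate, to be checked again for the
   shifted pair. *)
move: F G; apply: shift_ind => [F G shF|F G i j ij IH] Fk Gk FG intF topF.
  have := shifted_bound sk kn erefl shF Fk Gk FG intF topF.
  have /= -> := @card_lower_layers _ (initseg n (k + t + s)) k s.+1 (ltnW sk).
  have := cardsID (ksubsets (initseg n (k + t + s)) (k + t)) F.
  rewrite (setIidPr topF) cards_draws cM cMC -!subnDA addnA.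
  (* Moving the sum to the left turns the integer inequality into one between naturals; the top sets
     in [F] then cancel against the first binomial coefficient. *)
  move=> <-; rewrite lerBrDr -!PoszD lez_nat -[in X in _ -> X]addnA.
  by rewrite -[(_ + _ + (_ + _))%N]addnA leq_add2l addnA.
rewrite -(card_shift i j F) -(card_shift i j G); apply: IH.
- exact: shift_uniform.
- exact: shift_uniform.
- exact: shift_cross.
- exact: shift_cross.
(* An initial segment containing [j] contains the smaller [i]. *)
- by apply: shift_ksubsets => //; rewrite !inE; apply: ltn_trans.
Qed.
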